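(* The forest polynomials $\{\mathfrak{P}_F:F\in\mathsf{For}\}$ form a $\mathbb{Z}$-basis of $\mathrm{Pol}=\mathbb{Z}[x_1,x_2,\ldots]$, and every $f\in\mathrm{Pol}$ can be written in this basis as $$f=\sum_{F\in\mathsf{For}}(\mathrm{ev}_0\,\mathsf{T}_F f)\,\mathfrak{P}_F .$$
   Context: $\mathbb{N}=\{1,2,\ldots\}$, $\mathrm{Pol}=\mathbb{Z}[x_1,x_2,\ldots]$, and $\mathrm{ev}_0 f=f(0,0,\ldots)$ is the constant term. For $i\ge 1$, $\mathsf{R}_i(f)=f(x_1,\ldots,x_{i-1},0,x_i,x_{i+1},\ldots)$ and $\mathsf{T}_i(f)=\frac{\mathsf{R}_{i+1}(f)-\mathsf{R}_i(f)}{x_i}$ for $f\in\mathrm{Pol}$. Forests: a binary tree is a finite rooted plane tree in which each node is either a leaf (no children) or internal, having an ordered pair of children $v_L,v_R$; $\ast$ is the tree with a single node (a leaf). An indexed forest is an infinite sequence $F=(T_1,T_2,\ldots)$ of binary trees, all but finitely many equal to $\ast$; $\mathsf{For}$ is the set of indexed forests, and $\varnothing$ is the forest all of whose trees are $\ast$. The leaves of $F$, read from left to right, are identified with $1,2,3,\ldots$. $\mathrm{IN}(F)$ is the finite set of internal nodes. For $v\in \mathrm{IN}(F)$, $\rho_F(v)\in\mathbb{N}$ is the leaf reached from $v$ by repeatedly passing to the left child. The product $F\cdot G$ is the forest obtained by identifying, for each $i$, the $i$-th leaf of $F$ with the root of the $i$-th tree of $G$; this is a monoid structure with identity $\varnothing$.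 Let $\underline{i}$ be the forest whose only nontrivial tree is its $i$-th tree, which has exactly one internal node. The $\underline{i}$ generate $\mathsf{For}$. Operators: for $F\in\mathsf{For}$, $\mathsf{T}_F=\mathsf{T}_{i_1}\cdots\mathsf{T}_{i_k}$ (composition of operators) for any expression $F=\underline{i_1}\cdots\underline{i_k}$; this is independent of the expression, and $\mathsf{T}_\varnothing=\mathrm{id}$. Forest polynomials: let $\mathcal{C}(F)$ be the set of $\kappa:\mathrm{IN}(F)\to\mathbb{N}$ such that for all $v\in \mathrm{IN}(F)$: $\kappa(v)\le\rho_F(v)$; if $v_L\in \mathrm{IN}(F)$ then $\kappa(v)\le\kappa(v_L)$; if $v_R\in \mathrm{IN}(F)$ then $\kappa(v)<\kappa(v_R)$. Then $\mathfrak{P}_F=\sum_{\kappa\in\mathcal{C}(F)}\prod_{v\in \mathrm{IN}(F)}x_{\kappa(v)}$. *)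

(* Defs.v *)
From HB Require Import structures.
From mathcomp Require Import all_boot all_order all_algebra.
From mathcomp Require Import finmap ring zify.
From mathcomp.multinomials Require Import monalg.

Set Implicit Arguments.
Unset Strict Implicit.
Unset Printing Implicit Defensive.

Import GRing.Theory.
Local Open Scope fset_scope.
Local Open Scope ring_scope.

(* All indices (variables, trees of a forest, leaves) start at 0 instead of 1:
   'x_i, R i, T i, fgen i are x_{i+1}, R_{i+1}, T_{i+1}, \underline{i+1}. *)

Notation Pol := {malg int[{cmonom nat}]}.

HB.lock Definition X (i : nat) : Pol := << ucm i >>.
Notation "''x_' i" := (X i) (at level 8, i at level 2, format "''x_' i").

Definition ev0 (f : Pol) : int := f@_(mone : {cmonom nat}).

Definition cmeval (s : nat -> Pol) (m : {cmonom nat}) : Pol :=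
  \prod_(j <- finsupp m) s j ^+ m j.

(* f(s 0, s 1, ...) *)
HB.lock Definition psubst (s : nat -> Pol) (f : Pol) : Pol :=
  mmap intr (cmeval s) f.

Definition R (i : nat) : Pol -> Pol :=
  psubst (fun j => if (j < i)%N then 'x_j else if j == i then 0 else 'x_j.-1).

Definition cmdivX (i : nat) (m : {cmonom nat}) : Pol :=
  if (0 < m i)%N then << divcm m (ucm i) >> else 0.

(* Quotient by 'x_i: monomials not divisible by 'x_i are dropped. T only uses
   it on multiples of 'x_i, see mulX_T. *)
HB.lock Definition divX (i : nat) (f : Pol) : Pol :=
  mmap intr (cmdivX i) f.

Definition T (i : nat) (f : Pol) : Pol := divX i (R i.+1 f - R i f).

Lemma XE i : << ucm i >> = 'x_i.
Proof. by rewrite X.unlock. Qed.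

Lemma cmevalE (s : nat -> Pol) (d : {fset nat}) (m : {cmonom nat}) :
  finsupp m `<=` d -> cmeval s m = \prod_(j <- d) s j ^+ m j.
Proof.
move=> sd; rewrite /cmeval (big_fset_incl _ sd) // => j jd.
by rewrite -cmE_eq0 => /eqP ->.
Qed.

Fact cmeval1 s : cmeval s mone = 1.
Proof. by rewrite /cmeval mdom1 big_seq_fset0. Qed.

Fact cmevalM s : {morph cmeval s : x y / mmul x y >-> x * y}.
Proof.
move=> m n; pose d := finsupp m `|` finsupp n.
rewrite !(@cmevalE s d) ?mdomD ?fsubsetUl ?fsubsetUr // -big_split /=.
by apply: eq_bigr => j _; rewrite cmM exprD.
Qed.

HB.instance Definition _ s :=
  isMultiplicative.Build {cmonom nat} Pol (cmeval s) (cmevalM s, cmeval1 s).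

Fact psubst_additive s : zmod_morphism (psubst s).
Proof. by rewrite psubst.unlock; exact: raddfB. Qed.

Fact psubst_multiplicative s : monoid_morphism (psubst s).
Proof. by rewrite psubst.unlock; split; [exact: rmorph1 | exact: rmorphM]. Qed.

HB.instance Definition _ s :=
  GRing.isZmodMorphism.Build Pol Pol (psubst s) (psubst_additive s).
HB.instance Definition _ s :=
  GRing.isMonoidMorphism.Build Pol Pol (psubst s) (psubst_multiplicative s).
HB.instance Definition _ i := GRing.RMorphism.on (R i).

Fact divX_additive i : zmod_morphism (divX i).
Proof. by rewrite divX.unlock; exact: raddfB. Qed.

HB.instance Definition _ i :=
  GRing.isZmodMorphism.Build Pol Pol (divX i) (divX_additive i).

Lemma malg_ind (P : Pol -> Prop) :
  P 0 -> (forall f g, P f -> P g -> P (f + g)) ->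
  (forall c m, P << c *g m >>) -> forall f, P f.
Proof. by move=> P0 PD PM f; rewrite [f]monalgE; elim/big_ind: _. Qed.

Lemma cmeval_ucm s i : cmeval s (ucm i) = s i.
Proof. by rewrite /cmeval mdomU big_seq_fset1 cmUU expr1. Qed.

Lemma psubstX s i : psubst s 'x_i = s i.
Proof. by rewrite X.unlock psubst.unlock mmapU mul1r cmeval_ucm. Qed.

Lemma RX i j :
  R i 'x_j = if (j < i)%N then 'x_j else if j == i then 0 else 'x_j.-1.
Proof. exact: psubstX. Qed.

Lemma malgU_scale c (m : {cmonom nat}) : << c *g m >> = c%:~R * << m >> :> Pol.
Proof.
rewrite mulrzl; apply/malgP => k; rewrite mcoeffU raddfMz /= mcoeffU.
by rewrite -mulrzl intz; case: eqP; rewrite ?mulr1 ?mulr0.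
Qed.

Lemma malgM_mono (m n : {cmonom nat}) : << m >> * << n >> = << mmul m n >> :> Pol.
Proof. by rewrite malgM_def fgmulUU mulr1. Qed.

Lemma malg1E : << mone >> = 1 :> Pol.
Proof. exact: mpolyC1E. Qed.

(* Every monomial is a product of variables. *)
Lemma cmonom_ind (P : {cmonom nat} -> Prop) :
  P mone -> (forall i m, P m -> P (mmul (ucm i) m)) -> forall m, P m.
Proof.
move=> P1 PM m; elim: {m}(mdeg m) {-2}m (leqnn (mdeg m)) => [|n IH] m.
  by rewrite leqn0 mdeg_eq0 => /eqP ->.
case: (posnP (mdeg m)) => [/eqP|]; first by rewrite mdeg_eq0 => /eqP ->.
rewrite lt0n mdeg_eq0 => m1 le_m.
have [i mi]: exists i, m i != 0%N.
  case: (fset_0Vmem (finsupp m)) => [m0|[i im]]; last by exists i; rewrite cmE_neq0.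
  case/negP: m1; apply/cmP => i; rewrite cm1; apply/eqP.
  by rewrite cmE_eq0 m0.
have -> : m = mmul (ucm i) (divcm m (ucm i)).
  apply/eqP/cmP => j; rewrite cmM divcmE cmU.
  by case: eqVneq => [<-|_]; rewrite ?subn0 // subnKC // lt0n.
apply: PM; apply: IH; move: le_m.
have {1}-> : m = mmul (ucm i) (divcm m (ucm i)).
  apply/eqP/cmP => j; rewrite cmM divcmE cmU.
  by case: eqVneq => [<-|_]; rewrite ?subn0 // subnKC // lt0n.
by rewrite mdegM mdegU add1n ltnS.
Qed.

Lemma pol_morph_eq (phi psi : {rmorphism Pol -> Pol}) :
  (forall i, phi 'x_i = psi 'x_i) -> phi =1 psi.
Proof.
move=> eqX; apply: malg_ind => [|f g ef eg|c m]; first by rewrite !rmorph0.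
  by rewrite !rmorphD ef eg.
rewrite malgU_scale !rmorphM !rmorph_int; congr (_ * _).
elim/cmonom_ind: m => [|i m IH]; first by rewrite malg1E !rmorph1.
rewrite -malgM_mono (rmorphM phi) (rmorphM psi).
by congr (_ * _); [have := eqX i; rewrite X.unlock | exact: IH].
Qed.

Lemma RXlt i j : (j < i)%N -> R i 'x_j = 'x_j.
Proof. by rewrite RX => ->. Qed.

Lemma RXeq i : R i 'x_i = 0.
Proof. by rewrite RX ltnn eqxx. Qed.

Lemma RXgt i j : (i <= j)%N -> R i 'x_j.+1 = 'x_j.
Proof. by move=> le_ij; rewrite RX ltnNge leqW //= gtn_eqF. Qed.

Lemma RRC i j f : (i <= j)%N -> R j (R i f) = R i (R j.+1 f).
Proof.
move=> le_ij; apply: (pol_morph_eq (phi := R j \o R i) (psi := R i \o R j.+1)).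
case=> [|k] /=.
  rewrite (@RXlt j.+1) //; case: i le_ij => [|i] le_ij.
    by rewrite RXeq rmorph0.
  by rewrite !RXlt // (leq_trans _ le_ij).
case: (ltngtP k.+1 i) => [lt_ki|lt_ik|eq_ki].
- by rewrite !RXlt //; lia.
- rewrite (@RXgt i) //; case: (ltngtP k j) => [lt_kj|lt_jk|->].
  + by rewrite RXlt // (@RXlt j.+1) // RXgt.
  + rewrite (@RXgt j.+1) //; case: k lt_jk lt_ik => // k lt_jk lt_ik.
    by rewrite !RXgt //; lia.
  + by rewrite !RXeq rmorph0.
- by rewrite {1}eq_ki RXeq rmorph0 (@RXlt j.+1) ?eq_ki ?RXeq.
Qed.

Definition zeroX (i : nat) : Pol -> Pol :=
  psubst (fun j => if j == i then 0 else 'x_j).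

HB.instance Definition _ i := GRing.RMorphism.on (zeroX i).

Lemma divX_mono i (m : {cmonom nat}) : divX i << m >> = cmdivX i m.
Proof. by rewrite divX.unlock mmapU mul1r. Qed.

Lemma divXZ i (c : int) f : divX i (c%:~R * f) = c%:~R * divX i f.
Proof. by rewrite !mulrzl raddfMz. Qed.

Lemma mulXK i : cancel ( *%R 'x_i) (divX i).
Proof.
apply: malg_ind => [|f g ef eg|c m]; first by rewrite mulr0 raddf0.
  by rewrite mulrDr raddfD; congr (_ + _).
rewrite malgU_scale mulrCA divXZ -XE malgM_mono divX_mono /cmdivX cmM cmUU.
congr (_ * << _ >>); apply/eqP/cmP => j.
by rewrite divcmE cmM addnC addnK.
Qed.

Lemma divX_decomp i f : f = 'x_i * divX i f + zeroX i f.
Proof.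
elim/malg_ind: f => [|f g ef eg|c m].
- by rewrite !raddf0 mulr0 addr0.
- by rewrite {1}ef {1}eg !raddfD /=; ring.
rewrite malgU_scale divXZ rmorphM rmorph_int mulrCA -mulrDr; congr (_ * _).
case: (posnP (m i)) => [m0|m_gt0].
  rewrite divX_mono /cmdivX m0 ltnn mulr0 add0r.
  rewrite /= /zeroX psubst.unlock mmapU mul1r.
  elim/cmonom_ind: m m0 => [|j m IH]; first by rewrite cmeval1.
  rewrite cmM cmU => /eqP; rewrite addn_eq0 eqb0 => /andP[/negPf ji /eqP m0].
  by rewrite cmevalM cmeval_ucm ji -malgM_mono XE; congr (_ * _); exact: IH.
have -> : m = mmul (ucm i) (divcm m (ucm i)).
  apply/eqP/cmP => j; rewrite cmM divcmE cmU.
  by case: eqVneq => [<-|_]; rewrite ?subn0 // subnKC.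
have -> : << mmul (ucm i) (divcm m (ucm i)) >> = 'x_i * << divcm m (ucm i) >> :> Pol.
  by rewrite -XE malgM_mono.
by rewrite mulXK rmorphM /= [zeroX i 'x_i]psubstX eqxx mul0r addr0.
Qed.

(* T i f is the exact quotient. *)
Lemma mulX_T i f : 'x_i * T i f = R i.+1 f - R i f.
Proof.
rewrite [RHS](divX_decomp i) -[LHS]addr0; congr (_ + _).
rewrite rmorphB /=; apply/esym/eqP; rewrite subr_eq0; apply/eqP.
apply: (pol_morph_eq (phi := zeroX i \o R i.+1) (psi := zeroX i \o R i)).
have Z j : zeroX i 'x_j = if j == i then 0 else 'x_j by exact: psubstX.
case=> [|k] /=.
  rewrite RXlt // Z; case: i Z => [|i] Z; first by rewrite RXeq rmorph0.
  by rewrite RXlt // Z.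
case: (ltngtP k i) => [lt_ki|lt_ik|->].
- rewrite (@RXlt i.+1) //; case: (ltngtP k.+1 i) => [lt_k1i|//|eq_ki]; first 2 last.
  + by rewrite eq_ki RXeq rmorph0 Z eqxx.
  + by rewrite RXlt.
  + by rewrite ltnS leqNgt lt_ki.
- by rewrite !RXgt // ltnW.
- by rewrite RXeq rmorph0 RXgt // Z eqxx.
Qed.

Lemma T_unique i f g : 'x_i * g = R i.+1 f - R i f -> g = T i f.
Proof. by rewrite -mulX_T => /(can_inj (mulXK i)). Qed.

Lemma TTC i j f : (i < j)%N -> T j (T i f) = T i (T j.+1 f).
Proof.
move=> lt_ij.
have RjX : R j 'x_i = 'x_i by rewrite RXlt.
have Rj1X : R j.+1 'x_i = 'x_i by rewrite RXlt // ltnW.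
have RiX : R i 'x_j.+1 = 'x_j by rewrite RXgt // ltnW.
have Ri1X : R i.+1 'x_j.+1 = 'x_j by rewrite RXgt.
have S k h l g : R k 'x_l = 'x_h ->
    'x_h * R k (T l g) = R k (R l.+1 g) - R k (R l g).
  by move=> <-; rewrite -[LHS](rmorphM (R k)) mulX_T (rmorphB (R k)).
apply/(can_inj (mulXK j))/(can_inj (mulXK i)).
rewrite mulX_T [RHS]mulrCA mulX_T !mulrBr !S //.
rewrite (@RRC i.+1 j.+1) 1?ltnW // (@RRC i j.+1) ?leqW 1?ltnW //.
rewrite (@RRC i.+1 j) // (@RRC i j) 1?ltnW //.
by ring.
Qed.

(* Binary trees. A node is a path from the root, false standing for a left
   step and true for a right step. *)
Inductive btree := Leaf | Node of btree & btree.

Fixpoint btree_encode (t : btree) : GenTree.tree void :=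
  match t with
  | Leaf => GenTree.Node 0 [::]
  | Node l r => GenTree.Node 1 [:: btree_encode l; btree_encode r]
  end.

Fixpoint btree_decode (t : GenTree.tree void) : option btree :=
  match t with
  | GenTree.Node 0 [::] => Some Leaf
  | GenTree.Node 1 [:: l; r] =>
      if (btree_decode l, btree_decode r) is (Some l', Some r')
      then Some (Node l' r') else None
  | _ => None
  end.

Fact btree_encodeK : pcancel btree_encode btree_decode.
Proof. by elim=> //= l -> r ->. Qed.

HB.instance Definition _ := Countable.copy btree (pcan_type btree_encodeK).

Fixpoint subtree (t : btree) (p : seq bool) : btree :=
  match t, p with
  | Node l r, b :: p' => subtree (if b then r else l) p'
  | _, _ => t
  end.

Fixpoint internals (t : btree) : seq (seq bool) :=
  if t is Node l r then
    [::] :: map (cons false) (internals l) ++ map (cons true) (internals r)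
  else [::].

(* from left to right *)
Fixpoint leaves (t : btree) : seq (seq bool) :=
  if t is Node l r then map (cons false) (leaves l) ++ map (cons true) (leaves r)
  else [:: [::]].

Definition nleaves (t : btree) : nat := size (leaves t).

Fixpoint leftmost (t : btree) : seq bool :=
  if t is Node l _ then false :: leftmost l else [::].

(* k-th leaf of t identified with the root of g k *)
Fixpoint graft (t : btree) (g : nat -> btree) : btree :=
  if t is Node l r then Node (graft l g) (graft r (fun k => g (nleaves l + k)%N))
  else g 0%N.

Notation forest := {fsfun nat -> btree with Leaf}.

Definition fempty : forest := [fsfun].

Definition fgen (i : nat) : forest := [fsfun fempty with i |-> Node Leaf Leaf].

(* number of the first leaf of the i-th tree *)
Definition offset (F : forest) (i : nat) : nat :=
  (\sum_(j < i) nleaves (F j))%N.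

Definition fbound (F : forest) : nat :=
  (\max_(i <- finsupp F) i.+1)%N.

(* The support bound is harmless, see fmulE. *)
Definition fmul (F G : forest) : forest :=
  [fsfun i in seq_fset tt (iota 0 (maxn (fbound F) (fbound G))) =>
     graft (F i) (fun k => G (offset F i + k)%N)].

Definition fprod (w : seq nat) : forest := foldr fmul fempty (map fgen w).

Lemma fbound_leaf (F : forest) i : (fbound F <= i)%N -> F i = Leaf.
Proof.
move=> le_bi; apply/fsfun_dflt/negP => iF; move: le_bi.
by rewrite leqNgt /fbound (big_rem i) //= leq_max leqnn.
Qed.

Lemma nleaves_gt0 t : (0 < nleaves t)%N.
Proof.
by elim: t => // l IHl r IHr; rewrite /nleaves size_cat size_map addn_gt0 IHl.
Qed.

Lemma nleaves_node l r : nleaves (Node l r) = (nleaves l + nleaves r)%N.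
Proof. by rewrite /nleaves size_cat !size_map. Qed.

Lemma leq_offset F i : (i <= offset F i)%N.
Proof.
rewrite -[X in (X <= _)%N]subn0 -[(i - 0)%N]muln1 -sum_nat_const_nat.
rewrite big_mkord; apply: leq_sum => j _; exact: nleaves_gt0.
Qed.

Lemma fmulE F G i : fmul F G i = graft (F i) (fun k => G (offset F i + k)%N).
Proof.
rewrite fsfun_fun seq_fsetE mem_iota /= add0n; case: ltnP => //.
rewrite geq_max => /andP[bF bG].
by rewrite (fbound_leaf bF) /= addn0 fbound_leaf // (leq_trans bG) // leq_offset.
Qed.

Lemma fgenE i j : fgen i j = if j == i then Node Leaf Leaf else Leaf.
Proof. by rewrite fsfun_withE; case: eqP => // _; rewrite fsfunE. Qed.

Lemma fmul_genE i G j :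
  fmul (fgen i) G j =
    if (j < i)%N then G j else if j == i then Node (G i) (G i.+1) else G j.+1.
Proof.
have off k : offset (fgen i) k = (k + (i < k))%N.
  elim: k => [|k IH]; first by rewrite /offset big_ord0.
  rewrite /offset big_ord_recr /= -/(offset _ k) IH fgenE /nleaves.
  by case: ltngtP => //= ?; lia.
rewrite fmulE off fgenE; case: ltngtP => //= [_|_|->]; rewrite ?addn0 ?addn1 //.
Qed.

Lemma fprod_tree t i w : exists w', forall j, fprod w' j =
  if (j < i)%N then fprod w j
  else if j == i then graft t (fun k => fprod w (i + k)%N)
  else fprod w (j + nleaves t).-1.
Proof.
elim: t i w => [|l IHl r IHr] i w.
  exists w => j; rewrite /= addn0 /nleaves /= addn1 /=.
  by case: ltngtP => // ->.
have [w1 E1] := IHr (i + nleaves l)%N w.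
have [w2 E2] := IHl i w1.
have nl := nleaves_gt0 l; have nr := nleaves_gt0 r.
have graft_lt t (g h : nat -> btree) :
    (forall k, (k < nleaves t)%N -> g k = h k) -> graft t g = graft t h.
  elim: t g h => [|t1 IH1 t2 IH2] g h /= gh; first exact: gh.
  congr Node.
    by apply: IH1 => k lt_k; apply: gh; rewrite nleaves_node ltn_addr.
  by apply: IH2 => k lt_k; apply: gh; rewrite nleaves_node ltn_add2l.
exists (i :: w2) => j; rewrite /fprod /= -/(fprod w2) fmul_genE !E2 ltnn eqxx.
case: ltngtP => [lt_ji|lt_ij|_].
- by rewrite E1 ltn_addr.
- rewrite ltnNge leqW ?(ltnW lt_ij) //= gtn_eqF ?leqW //.
  rewrite E1 nleaves_node ltnNge.
  have -> : (i + nleaves l <= (j.+1 + nleaves l).-1)%N by lia.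
  by rewrite /= gtn_eqF; [congr (fprod w _); lia | lia].
- rewrite ltnNge leqnSn /= gtn_eqF //; congr Node.
    by apply: graft_lt => k lt_k; rewrite E1 ltn_add2l lt_k.
  by rewrite E1 ltnn eqxx; apply: graft_lt => k _; rewrite addnA.
Qed.

Lemma fprod_surj (F : forest) : exists w, fprod w == F.
Proof.
move: (fbound F) (@fbound_leaf F) => n; elim: n F => [|n IH] F Fn.
  by exists [::]; apply/eqP/fsfunP => i; rewrite /fprod /= fsfunE Fn.
pose H : forest := [fsfun j in seq_fset tt (iota 0 n) => F j].
have HE j : H j = if (j < n)%N then F j else Leaf.
  by rewrite fsfun_fun seq_fsetE mem_iota.
have [|w /eqP Hw] := IH H; first by move=> i le_ni; rewrite HE ltnNge le_ni.
have [w' Ew'] := fprod_tree (F n) n w.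
exists w'; apply/eqP/fsfunP => j; rewrite Ew' Hw !HE; case: ltngtP => // [lt_nj|->].
  rewrite ltnNge (Fn _ lt_nj).
  by have -> : (n <= (j + nleaves (F n)).-1)%N by have := nleaves_gt0 (F n); lia.
have graft_leaf t g : (forall k, g k = Leaf) -> graft t g = t.
  by elim: t g => [|l IHl r IHr] g gE /=; rewrite ?gE // IHl // IHr.
by apply: graft_leaf => k; rewrite HE ltnNge leq_addr.
Qed.

Definition Tword (w : seq nat) : Pol -> Pol := foldr (fun i U => T i \o U) id w.

(* The choice of the expression of F is irrelevant, see TForE. *)
Definition TFor (F : forest) : Pol -> Pol := Tword (xchoose (fprod_surj F)).

Fixpoint tword (t : btree) (i : nat) : seq nat :=
  if t is Node l r then i :: tword r i.+1 ++ tword l i else [::].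

Definition fword (F : nat -> btree) (n : nat) : seq nat :=
  flatten [seq tword (F i) i | i <- rev (iota 0 n)].

Lemma fwordS F n : fword F n.+1 = tword (F n) n ++ fword F n.
Proof. by rewrite /fword -[X in iota 0 X]addn1 iotaD rev_cat. Qed.

Lemma Tword_cat v w f : Tword (v ++ w) f = Tword v (Tword w f).
Proof. by elim: v => //= i v ->. Qed.

Lemma T_tword t i j f : (i < j)%N ->
  Tword (tword t j) (T i f) = T i (Tword (tword t j.+1) f).
Proof.
elim: t j f => //= l IHl r IHr j f lt_ij.
rewrite !Tword_cat IHl // IHr; last exact: leqW.
by rewrite TTC.
Qed.

Lemma fword_leaf F n m : (n <= m)%N -> (forall i, (n <= i)%N -> F i = Leaf) ->
  fword F m = fword F n.
Proof.
move=> le_nm Fn; elim: m le_nm => [|m IH]; first by rewrite leqn0 => /eqP ->.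
rewrite leq_eqVlt => /predU1P[-> //|]; rewrite ltnS => le_nm.
by rewrite fwordS Fn //= IH.
Qed.

Lemma eq_fword F G n : (forall i, (i < n)%N -> F i = G i) -> fword F n = fword G n.
Proof.
move=> FG; congr flatten; apply/eq_in_map => i.
by rewrite mem_rev mem_iota => /= lt_in; rewrite FG.
Qed.

Lemma Tword_gen i G n f : (i < n)%N ->
  Tword (fword (fmul (fgen i) G) n) f = T i (Tword (fword G n.+1) f).
Proof.
elim: n f => // n IH f; rewrite ltnS leq_eqVlt => /predU1P[<-|lt_in].
  rewrite !fwordS !Tword_cat fmul_genE ltnn eqxx /= Tword_cat.
  rewrite (@eq_fword (fmul (fgen i) G) G) // => j lt_ji.
  by rewrite fmul_genE lt_ji.
rewrite fwordS Tword_cat IH // T_tword // (fwordS G n.+1) Tword_cat.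
by rewrite fmul_genE ltnNge (ltnW lt_in) /= gtn_eqF.
Qed.

Lemma Tword_fword w n f : (forall i, (n <= i)%N -> fprod w i = Leaf) ->
  Tword w f = Tword (fword (fprod w) n) f.
Proof.
elim: w n f => [|i w IH] n f wn.
  by rewrite (@fword_leaf _ 0) // => j _; rewrite /fprod /= fsfunE.
pose m := maxn n (maxn i.+1 (fbound (fprod w))).
rewrite -(@fword_leaf _ n m) ?leq_maxl // [fprod _]/(fmul (fgen i) (fprod w)).
rewrite Tword_gen; last by rewrite /m; lia.
rewrite /= (IH m.+1) // => j le_mj; apply: fbound_leaf; rewrite /m in le_mj; lia.
Qed.

Lemma TForE w : TFor (fprod w) =1 Tword w.
Proof.
move=> f; rewrite /TFor; have := xchooseP (fprod_surj (fprod w)).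
move: (xchoose _) => v /eqP Evw.
have H u : fprod u = fprod w ->
    Tword u f = Tword (fword (fprod w) (fbound (fprod w))) f.
  by move=> <-; apply: Tword_fword => i; exact: fbound_leaf.
by rewrite (H v) ?(H w).
Qed.

Definition IN (F : forest) : {fset nat * seq bool} :=
  seq_fset tt [seq (i, p) | i <- finsupp F, p <- internals (F i)].

Definition lchild (v : nat * seq bool) := (v.1, rcons v.2 false).
Definition rchild (v : nat * seq bool) := (v.1, rcons v.2 true).

Definition rho (F : forest) (v : nat * seq bool) : nat :=
  (offset F v.1
   + index (v.2 ++ leftmost (subtree (F v.1) v.2)) (leaves (F v.1)))%N.

(* The bound kappa(v) <= rho_F(v) is part of the type of kappa. *)
Definition colorings (F : forest) :
    {set {dffun forall v : IN F, 'I_(rho F (val v)).+1}} :=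
  [set kappa : {dffun forall v : IN F, 'I_(rho F (val v)).+1} |
    [forall v : IN F, forall w : IN F,
       ((val w == lchild (val v)) ==> (kappa v <= kappa w)%N)
       && ((val w == rchild (val v)) ==> (kappa v < kappa w)%N)]].

Definition forest_poly (F : forest) : Pol :=
  \sum_(kappa in colorings F) \prod_(v : IN F) 'x_(kappa v).

Section Basis.
Variables (A : nzRingType) (M : lmodType A) (I : choiceType) (b : I -> M).

Definition lincomb (c : {fsfun I -> A with 0}) : M :=
  \sum_(i <- finsupp c) c i *: b i.

Definition is_basis : Prop :=
  (forall x, exists c, x = lincomb c)
  /\ (forall c, lincomb c = 0 -> forall i, c i = 0).

End Basis.

(* Main.v *)
From HB Require Import structures.
From mathcomp Require Import all_boot all_order all_algebra.
From mathcomp Require Import finmap ring zify.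
From mathcomp.multinomials Require Import monalg.
Require Import Defs.

Set Implicit Arguments.
Unset Strict Implicit.
Unset Printing Implicit Defensive.

Import GRing.Theory.
Local Open Scope fset_scope.
Local Open Scope ring_scope.

(** The proof rests on how the trimming operators [T i] act on forest
    polynomials, with respect to right multiplication by a generator:
    [T i P_(G . i) = P_G], and [T i P_F = 0] when [F] is not of the form
    [G . i] ([T_forest_poly_fgen], [T_forest_poly_eq0]).  Iterating, and since
    [P_F] has constant term 0 unless [F] is empty, the functional
    [f |-> ev0 (T_w f)] sends [P_F] to 1 if the word [w] spells [F] and to 0
    otherwise ([ev0_Tword_forest_poly]).  Hence the coefficients of a linear
    combination of forest polynomials can be read off, which gives linear
    independence and forces the coefficients of any expansion.

    To understand [T i P_F], let the bounds on the colors be arbitrary: attach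
    to the leaf number [m] a strict upper bound [b m] for the colors of the
    nodes whose leftmost leaf is [m].  Substituting 0 for [x_i] and shifting
    the later variables only replaces [b] by [lower i \o b] ([R_tpoly]), so
    [R i.+1 P_F] and [R i P_F] are the same sum for two families of bounds
    which differ only at leaf [i], where the first allows the color [i] and
    the second does not.  Their difference collects the colorings that use
    the color [i] on the chain of nodes with leftmost leaf [i]; as colors
    increase weakly to the left, it is the last node of that chain that has
    color [i].  If its right child is internal, its color exceeds [i] and must
    be below the bound [i.+1] at leaf [i.+1]: no such coloring exists.
    Otherwise that node is a cherry over the leaves [i] and [i.+1], and erasing
    it leaves [x_i] times the polynomial of the trimmed forest
    ([tpoly_graft_cherry], [tpoly_no_cherry]).

    To see that forest polynomials span, note that [T i] lowers the degree and
    kills polynomials in the variables before [x_i]; so [T_w f] vanishes for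
    all but finitely many words, and [f - \sum_F (ev0 (T_F f)) P_F] makes
    sense.  By duality it is killed by all the functionals [ev0 \o T_w].  A
    polynomial [g] with this property is 0 ([ev0_Tword_eq0]): by induction on
    the degree every [T i g] is 0, so [R i g] does not depend on [i]; this
    common value is [g] itself as [R i g = g] for large [i], and iterating
    [R 0 g = g] kills all variables, so that [g] is a constant, equal to
    [ev0 g = 0]. *)

(** * Sums over the colorings of a tree *)

Section TreeSum.
Variables (A : comNzRingType) (x : nat -> A).

(** The root has the first leaf of the tree as its leftmost leaf, hence the bound
    [b 0].  The lower bound [a] is what the parent's color imposes: at least
    that color for a left child, strictly more for a right child. *)
Fixpoint tpoly (t : btree) (b : nat -> nat) (a : nat) : A :=
  if t is Node l r then
    \sum_(a <= k < b 0%N)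
      x k * (tpoly l b k * tpoly r (fun m => b (nleaves l + m)%N) k.+1)
  else 1.

Lemma tpoly_leaf b a : tpoly Leaf b a = 1.
Proof. by []. Qed.

Lemma tpoly_node l r b a : tpoly (Node l r) b a =
  \sum_(a <= k < b 0%N)
    x k * (tpoly l b k * tpoly r (fun m => b (nleaves l + m)%N) k.+1).
Proof. by []. Qed.

Lemma eq_in_tpoly t (b b' : nat -> nat) a :
  (forall m, (m < nleaves t)%N -> b m = b' m) -> tpoly t b a = tpoly t b' a.
Proof.
elim: t b b' a => [|l IHl r IHr] b b' a; first by rewrite !tpoly_leaf.
rewrite nleaves_node => eqb; have nl := nleaves_gt0 l.
rewrite !tpoly_node eqb ?ltn_addr //; apply: eq_bigr => k _; congr (_ * (_ * _)).
  by apply: IHl => m lt_m; rewrite eqb ?ltn_addr.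
by apply: IHr => m lt_m; rewrite eqb // ltn_add2l.
Qed.

Lemma tpoly_empty l r b a : (b 0%N <= a)%N -> tpoly (Node l r) b a = 0.
Proof. by move=> le_ba; rewrite tpoly_node big_geq. Qed.

End TreeSum.

Arguments tpoly : simpl never.

(** Effect on a strict upper bound of dropping the color [i] and relabelling the
    colors above it. *)
Definition lower (i k : nat) : nat := (k - (i < k))%N.

Lemma big_lower i a b (A : nmodType) (G : nat -> A) :
  \sum_(lower i a <= k < lower i b) G k =
  \sum_(a <= k < b | k != i) G (lower i k).
Proof.
case: (leqP b a) => [le_ba|lt_ab].
  by rewrite !big_geq // /lower; case: ltnP; case: ltnP; lia.
elim: b lt_ab => // b IH; rewrite ltnS leq_eqVlt => /predU1P[<-|lt_ab].
  rewrite [RHS]big_mkcond big_nat1; case: eqVneq => [->|neq_ai].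
    by rewrite big_geq // /lower ltnn ltnSn; lia.
  have -> : lower i a.+1 = (lower i a).+1.
    by rewrite /lower ltnS; case: ltngtP neq_ai; lia.
  by rewrite big_nat1.
rewrite [RHS]big_mkcond big_nat_recr /=; last exact: ltnW.
rewrite -big_mkcond -IH //; case: eqVneq => [->|neq_bi].
  have -> : lower i i.+1 = lower i i by rewrite /lower ltnn ltnSn; lia.
  by rewrite addr0.
have -> : lower i b.+1 = (lower i b).+1.
  by rewrite /lower ltnS; case: ltngtP neq_bi; lia.
by rewrite big_nat_recr //= /lower; case: ltnP; case: ltnP; lia.
Qed.

Lemma RX_lower i k : R i 'x_k = if k == i then 0 else 'x_(lower i k).
Proof.
by rewrite RX /lower; case: ltngtP => //=; rewrite ?subn0 ?subn1.
Qed.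

(** [R i] discards the colorings using the color [i] and relabels the others.
    The relabelling is increasing on the remaining colors, so it preserves the
    weak and strict inequalities between parents and children. *)
Lemma R_tpoly i t b a :
  R i (tpoly X t b a) = tpoly X t (fun m => lower i (b m)) (lower i a).
Proof.
elim: t b a => [|l IHl r IHr] b a; first by rewrite !tpoly_leaf rmorph1.
rewrite !tpoly_node rmorph_sum big_lower [RHS]big_mkcond; apply: eq_bigr => k _.
rewrite !rmorphM /= RX_lower IHl IHr; case: eqVneq => [|neq_ki]; first by rewrite mul0r.
have -> // : lower i k.+1 = (lower i k).+1.
by rewrite /lower ltnS; case: ltngtP neq_ki; lia.
Qed.

(** * The monoid of forests *)

Lemma graft_leaves t g : (forall k, (k < nleaves t)%N -> g k = Leaf) -> graft t g = t.
Proof.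
elim: t g => [|l IHl r IHr] g gE /=; first exact: gE.
rewrite IHl => [|k lt_k]; last by rewrite gE // nleaves_node ltn_addr.
by rewrite IHr // => k lt_k; rewrite gE // nleaves_node ltn_add2l.
Qed.

Lemma eq_in_graft t (g h : nat -> btree) :
  (forall k, (k < nleaves t)%N -> g k = h k) -> graft t g = graft t h.
Proof.
elim: t g h => [|l IHl r IHr] g h /= gh; first exact: gh.
congr Node.
  by apply: IHl => k lt_k; apply: gh; rewrite nleaves_node ltn_addr.
by apply: IHr => k lt_k; apply: gh; rewrite nleaves_node ltn_add2l.
Qed.

Lemma nleaves_graft t g :
  nleaves (graft t g) = (\sum_(k < nleaves t) nleaves (g k))%N.
Proof.
elim: t g => [|l IHl r IHr] g; first by rewrite /= big_ord1.
by rewrite /= !nleaves_node IHl IHr big_split_ord.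
Qed.

Lemma graftA t g h :
  graft (graft t g) h =
  graft t (fun k => graft (g k) (fun m => h (\sum_(j < k) nleaves (g j) + m)%N)).
Proof.
elim: t g h => [|l IHl r IHr] g h /=.
  by apply: eq_in_graft => m _; rewrite big_ord0.
rewrite IHl IHr; congr Node; apply: eq_in_graft => k _; apply: eq_in_graft => m _.
by rewrite nleaves_graft addnA big_split_ord.
Qed.

Lemma offset0 F : offset F 0 = 0%N.
Proof. by rewrite /offset big_ord0. Qed.

Lemma offsetS F j : offset F j.+1 = (offset F j + nleaves (F j))%N.
Proof. by rewrite /offset big_ord_recr. Qed.

Lemma offset_fmul F G j : offset (fmul F G) j = offset G (offset F j).
Proof.
elim: j => [|j IH]; first by rewrite !offset0.
rewrite !offsetS IH fmulE nleaves_graft.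
by rewrite /offset big_split_ord.
Qed.

Lemma fmulA : associative fmul.
Proof.
move=> F G H; apply/fsfunP => j; rewrite !fmulE graftA.
apply: eq_in_graft => k _; rewrite fmulE; apply: eq_in_graft => m _.
rewrite offset_fmul; congr (H _); rewrite addnA; congr (_ + _)%N.
by rewrite /offset big_split_ord.
Qed.

Lemma fmul0f : left_id fempty fmul.
Proof.
move=> F; apply/fsfunP => j; rewrite fmulE fsfunE /= addn0; congr (F _).
by elim: j => [|j IH]; rewrite ?offset0 ?offsetS // IH fsfunE /nleaves /= addn1.
Qed.

Lemma fmulf0 : right_id fempty fmul.
Proof.
by move=> F; apply/fsfunP => j; rewrite fmulE graft_leaves // => k _; rewrite fsfunE.
Qed.

Lemma fprod_rcons w i : fprod (rcons w i) = fmul (fprod w) (fgen i).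
Proof.
elim: w => [|j w IH]; first by rewrite /= /fprod /= fmul0f fmulf0.
by rewrite rcons_cons /fprod /= -!/(fprod _) IH fmulA.
Qed.

(** Grafting [cherry p] on a tree adds a terminal internal node at leaf [p]; this
    is what right multiplication by a generator does to one tree. *)
Definition cherry (p k : nat) : btree := if k == p then Node Leaf Leaf else Leaf.

Lemma nleaves_cherry t p :
  (p < nleaves t)%N -> nleaves (graft t (cherry p)) = (nleaves t).+1.
Proof.
move=> lt_p; rewrite nleaves_graft (bigD1 (Ordinal lt_p)) //= /cherry eqxx.
rewrite [X in (_ + X)%N](eq_bigr (fun _ => 1%N)); last first.
  by move=> k; rewrite -val_eqE /= => /negPf ->.
by rewrite sum_nat_const muln1 cardC1 card_ord {1}/nleaves /=; lia.
Qed.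

Lemma graft_cherry_out t p :
  (nleaves t <= p)%N -> graft t (cherry p) = t.
Proof.
by move=> le_p; rewrite graft_leaves // => k lt_k; rewrite /cherry ltn_eqF // (leq_trans lt_k).
Qed.

(** * Trimming a tree *)

(** The situation met when comparing [R i.+1] and [R i] on a tree whose leaf [p]
    is the leaf [i] of the forest.  That [b] takes the same value at [p] and
    [p.+1] is why erasing a cherry there loses nothing: either bound serves for
    the merged leaf. *)
Definition split_at (p i : nat) (b b' : nat -> nat) : Prop :=
  [/\ forall k, (k < p)%N -> (b k <= i)%N, b p = i.+1, b p.+1 = i.+1,
      b' p = i & forall m, m != p -> b' m = b m].

Lemma split_at_shift n p i b b' : (n <= p)%N -> split_at p i b b' ->
  split_at (p - n) i (fun m => b (n + m)%N) (fun m => b' (n + m)%N).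
Proof.
move=> le_np [lt_b bp bp1 b'p eqb]; split=> [k lt_k||||m neq_m].
- by apply: lt_b; lia.
- by rewrite subnKC.
- by rewrite addnS subnKC.
- by rewrite subnKC.
- by apply: eqb; apply: contraNneq neq_m => <-; rewrite addnC addnK.
Qed.

Section Split.
Variables (A : comNzRingType) (x : nat -> A).

(** Only the sum over the colors of a root whose leftmost leaf is [p] changes, by
    its term of index [i]; there, that term will vanish. *)
Lemma split_root p i b b' a (f : nat -> A) :
  split_at p i b b' -> (a <= i)%N -> (p = 0%N -> f i = 0) ->
  \sum_(a <= k < b 0%N) f k = \sum_(a <= k < b' 0%N) f k.
Proof.
move=> [_ bp _ b'p eqb] le_ai fi; case: p => [|p] in bp b'p eqb fi *.
  by rewrite bp b'p big_nat_recr //= fi // addr0.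
by rewrite eqb.
Qed.

Lemma split_root_le p i b b' k : split_at p i b b' -> (k < b 0%N)%N -> (k <= i)%N.
Proof.
case: p => [|p] [lt_b bp _ _ _] lt_k; first by rewrite bp in lt_k.
by apply: leq_trans (lt_b 0%N _); rewrite // ltnW.
Qed.

Lemma graft_cherry_node l r p : graft (Node l r) (cherry p) =
  if (p < nleaves l)%N then Node (graft l (cherry p)) r
  else Node l (graft r (cherry (p - nleaves l))).
Proof.
rewrite /=; case: ltnP => [lt_p|le_p]; congr Node.
- by rewrite graft_leaves // => k _; rewrite /cherry gtn_eqF // ltn_addr.
- exact: graft_cherry_out.
- apply: eq_in_graft => k _; rewrite /cherry; congr (if _ then _ else _); lia.
Qed.

(** By induction on [t]: the cherry itself contributes the single monomial
    [x i] to the difference, and above it the sums run over the same colors.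
    When [p] is the first leaf, the color [i] of the root is allowed by [b] and
    not by [b'], but it would force the left child, subject to [b'], to have a
    color at least [i] and below [i]. *)
Lemma tpoly_graft_cherry t p i b b' a :
  split_at p i b b' -> (p < nleaves t)%N -> (a <= i)%N ->
  tpoly x (graft t (cherry p)) b a =
  tpoly x (graft t (cherry p)) b' a + x i * tpoly x t (fun m => b (bump p m)) a.
Proof.
elim: t p b b' a => [|l IHl r IHr] p b b' a sb lt_p le_ai.
  case: p => // in sb lt_p *; case: sb => _ b0 _ b'0 _.
  by rewrite /= !tpoly_node b0 b'0 big_nat_recr //= !tpoly_leaf !mulr1.
(* When [p] is the first leaf, [b] takes the same value at the next leaf. *)
have c0 : b (bump p 0) = b 0%N by case: p sb {lt_p} => // -[_ -> ->].
have nl := nleaves_gt0 l.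
rewrite graft_cherry_node; case: ltnP => [lt_pl|le_lp].
  rewrite !tpoly_node -(@split_root p i b b' a _ sb) //; last first.
    move=> p0; have [l1 [l2 El]] : exists l1 l2, graft l (cherry p) = Node l1 l2.
      rewrite p0; case: (l) => [|l1 l2] /=; first by exists Leaf, Leaf.
      by eexists; eexists.
    rewrite El tpoly_empty ?mul0r ?mulr0 //.
    by case: sb => _ _ _; rewrite p0 => ->.
  rewrite c0 mulr_sumr -big_split; apply: eq_big_nat => k /andP[_ lt_k].
  have le_ki := split_root_le sb lt_k.
  rewrite (IHl p b b' k) // nleaves_cherry //.
  have -> : tpoly x r (fun m => b' ((nleaves l).+1 + m)%N) k.+1 =
            tpoly x r (fun m => b ((nleaves l).+1 + m)%N) k.+1.
    apply: eq_in_tpoly => m _; case: sb => _ _ _ _ eqb; apply: eqb; lia.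
  have -> : tpoly x r (fun m => b (bump p (nleaves l + m))) k.+1 =
            tpoly x r (fun m => b ((nleaves l).+1 + m)%N) k.+1.
    by apply: eq_in_tpoly => m _; rewrite /bump (leq_trans (ltnW lt_pl)) // leq_addr.
  by rewrite /=; ring.
rewrite !tpoly_node -(@split_root p i b b' a _ sb) //; last by lia.
rewrite c0 mulr_sumr -big_split; apply: eq_big_nat => k /andP[_ lt_k].
have lt_ki : (k < i)%N by case: (sb) => H _ _ _ _; apply: leq_trans (H 0%N _); lia.
rewrite (IHr _ _ _ _ (split_at_shift le_lp sb)) //; last first.
  by rewrite nleaves_node in lt_p; lia.
have -> : tpoly x l b' k = tpoly x l b k.
  by apply: eq_in_tpoly => m lt_m; case: sb => _ _ _ _ eqb; apply: eqb; lia.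
have -> : tpoly x l (fun m => b (bump p m)) k = tpoly x l b k.
  by apply: eq_in_tpoly => m lt_m; rewrite /bump leqNgt (leq_trans lt_m).
have -> : tpoly x r (fun m => b (bump p (nleaves l + m))) k.+1 =
          tpoly x r (fun m => b (nleaves l + bump (p - nleaves l) m)%N) k.+1.
  by apply: eq_in_tpoly => m _; rewrite /bump; congr b; lia.
by rewrite /=; ring.
Qed.

(** If leaf [p] is a right child or the whole tree, no bound involves it.  If it is the left child
    of a node whose right child is internal, giving that node the color [i]
    leaves no color for the right child. *)
Lemma tpoly_no_cherry t p i :
  (exists2 t', (p < nleaves t')%N & t = graft t' (cherry p)) \/
  (forall b b' a, split_at p i b b' -> (p < nleaves t)%N -> (a <= i)%N ->
     tpoly x t b a = tpoly x t b' a).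
Proof.
elim: t p => [|l IHl r IHr] p; first by right=> b b' a _ _ _; rewrite !tpoly_leaf.
have nl := nleaves_gt0 l.
case: (ltnP p (nleaves l)) => [lt_p|le_p].
  case: (IHl p) => [[l' lt_p' ->]|eql].
    left; exists (Node l' r); first by rewrite nleaves_node ltn_addr.
    by rewrite graft_cherry_node lt_p'.
  case: l => [|l1 l2] in IHl nl lt_p eql *; last first.
    right=> b b' a sb _ le_ai; rewrite !(tpoly_node _ (Node l1 l2)).
    rewrite -(@split_root p i b b' a _ sb) //.
      apply: eq_big_nat => k /andP[_ lt_k]; have le_ki := split_root_le sb lt_k.
      rewrite (eql b b') //; congr (_ * (_ * _)).
      by apply: eq_in_tpoly => m _; case: sb => _ _ _ _ eqb; rewrite eqb //; lia.
    by move=> p0; rewrite tpoly_empty ?mul0r ?mulr0 //; case: sb => _ _ _; rewrite p0 => ->.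
  have p0 : p = 0%N by case: p lt_p {eql}.
  case: r => [|r1 r2] in IHr *; first by left; exists Leaf; rewrite ?p0.
  right=> b b' a sb _ le_ai; rewrite !(tpoly_node _ Leaf).
  case: sb; rewrite p0 => _ b0 b1 b'0 eqb.
  rewrite b0 b'0 big_nat_recr //= [X in _ + X = _]mulrC tpoly_empty ?b1 // mulr0 mul0r addr0.
  apply: eq_bigr => k _; rewrite !tpoly_leaf; congr (_ * (_ * _)).
  by apply: eq_in_tpoly => m _; rewrite eqb.
case: (IHr (p - nleaves l)%N) => [[r' lt_p' ->]|eqr].
  left; exists (Node l r'); first by rewrite nleaves_node; lia.
  by rewrite graft_cherry_node ltnNge le_p.
right=> b b' a sb; rewrite nleaves_node => lt_p le_ai.
rewrite !tpoly_node -(@split_root p i b b' a _ sb) //; last by lia.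
apply: eq_big_nat => k /andP[_ lt_k].
have lt_ki : (k < i)%N by case: (sb) => H _ _ _ _; apply: leq_trans (H 0%N _); lia.
rewrite (eqr _ _ _ (split_at_shift le_p sb)) //; last by lia.
congr (_ * (_ * _)).
by apply: eq_in_tpoly => m lt_m; case: sb => _ _ _ _ eqb; rewrite eqb //; lia.
Qed.

(** Number the leaves of the forest from left to right: the trees are independent
    of each other, each seeing its own window of [b].  [fpoly F succn n] is the
    forest polynomial of [F] when all trees from [n] on are trivial, see
    [forest_polyE]. *)
Definition fpoly (F : forest) (b : nat -> nat) (n : nat) : A :=
  \prod_(j < n) tpoly x (F j) (fun m => b (offset F j + m)%N) 0.

Lemma fpolyS F b n :
  fpoly F b n.+1 = fpoly F b n * tpoly x (F n) (fun m => b (offset F n + m)%N) 0.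
Proof. by rewrite /fpoly big_ord_recr. Qed.

Lemma offset_fgen i k : offset (fgen i) k = (k + (i < k))%N.
Proof.
elim: k => [|k IH]; first by rewrite offset0.
by rewrite offsetS IH fgenE /nleaves; case: ltngtP => //= ?; lia.
Qed.

Lemma leq_offset2 F j k : (j <= k)%N -> (offset F j <= offset F k)%N.
Proof.
move=> le_jk; rewrite -(subnKC le_jk); elim: (k - j)%N => [|m IH]; rewrite ?addn0 //.
by rewrite addnS offsetS (leq_trans IH) ?leq_addr.
Qed.

Lemma fmul_fgenE G i j : fmul G (fgen i) j =
  if (offset G j <= i)%N then graft (G j) (cherry (i - offset G j)) else G j.
Proof.
rewrite fmulE; case: leqP => [le_oi|lt_io]; last first.
  by rewrite graft_leaves // => k _; rewrite fgenE gtn_eqF // ltn_addr.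
apply: eq_in_graft => k _; rewrite fgenE /cherry; congr (if _ then _ else _); lia.
Qed.

(** After [R i.+1] and [R i], the bounds [m.+1] become [m] for [m > i] and stay
    [m.+1] for [m < i] alike; at leaf [i] they become [i.+1] and [i]. *)
Lemma split_hi_lo o i : (o <= i)%N ->
  split_at (i - o) i (fun m => lower i.+1 (o + m).+1) (fun m => lower i (o + m).+1).
Proof.
move=> le_oi; split=> [k lt_k||||m neq_m]; rewrite /lower; lia.
Qed.

Lemma fpoly_fmul_lo G i n : (offset G n <= i)%N ->
  fpoly (fmul G (fgen i)) (lower i \o succn) n = fpoly G succn n.
Proof.
elim: n => [|n IH]; first by rewrite /fpoly !big_ord0.
rewrite offsetS => le_i; have lt_i : (offset G n <= i)%N by lia.
rewrite !fpolyS IH // fmul_fgenE lt_i graft_cherry_out; last by lia.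
congr (_ * _); apply: eq_in_tpoly => m lt_m.
by rewrite offset_fmul offset_fgen /lower /=; lia.
Qed.

(** Exactly one tree contains leaf [i]; the trees before it are unaffected by
    either bound, and for those after it the shift of the bounds by 1 makes up
    for the leaf lost when the cherry is erased. *)
Lemma fpoly_fmul_fgen G i n :
  fpoly (fmul G (fgen i)) (lower i.+1 \o succn) n =
  fpoly (fmul G (fgen i)) (lower i \o succn) n +
  (if (i < offset G n)%N then x i * fpoly G succn n else 0).
Proof.
elim: n => [|n IH]; first by rewrite offset0 addr0 /fpoly !big_ord0.
rewrite !fpolyS IH offset_fmul offset_fgen fmul_fgenE offsetS.
case: (leqP (offset G n) i) => [le_oi|lt_io]; last first.
  rewrite ltn_addr //.
  have -> : tpoly x (G n) (fun m => (lower i.+1 \o succn) (offset G n + true + m)%N) 0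
          = tpoly x (G n) (fun m => (offset G n + m).+1) 0.
    by apply: eq_in_tpoly => m _; rewrite /lower /=; lia.
  have -> : tpoly x (G n) (fun m => (lower i \o succn) (offset G n + true + m)%N) 0
          = tpoly x (G n) (fun m => (offset G n + m).+1) 0.
    by apply: eq_in_tpoly => m _; rewrite /lower /=; lia.
  by rewrite mulrDl -!mulrA.
rewrite addn0 addr0; case: (ltnP i) => [lt_i|le_i].
  rewrite (tpoly_graft_cherry (split_hi_lo le_oi)) //; last by lia.
  rewrite mulrDr; congr (_ + _); rewrite fpoly_fmul_lo // mulrCA.
  congr (_ * (_ * _)); apply: eq_in_tpoly => m _.
  by rewrite /lower /bump; lia.
rewrite addr0 graft_cherry_out; last by lia.
congr (_ * _); apply: eq_in_tpoly => m lt_m; rewrite /lower /=; lia.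
Qed.

Lemma fmul_fgen_surj (F : forest) i j t :
  (offset F j <= i)%N -> (i - offset F j < nleaves t)%N ->
  F j = graft t (cherry (i - offset F j)) -> exists G, F = fmul G (fgen i).
Proof.
move=> le_oi lt_i Fj.
have [G GE] : exists G : forest, forall k, G k = if k == j then t else F k.
  by exists [fsfun F with j |-> t] => k; rewrite fsfun_withE.
exists G.
have oG k : (k <= j)%N -> offset G k = offset F k.
  elim: k => [|k IH] lt_k; first by rewrite !offset0.
  rewrite !offsetS IH; last exact: ltnW.
  by rewrite GE ltn_eqF.
have oG' k : (j < k)%N -> (i < offset G k)%N.
  move=> lt_jk; apply: leq_trans (leq_offset2 _ lt_jk).
  by rewrite offsetS oG // GE eqxx; lia.
apply/fsfunP => k; rewrite fmul_fgenE GE.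
case: (ltngtP k j) => [lt_kj|lt_jk|->]; last by rewrite oG // le_oi -Fj.
  have le_o : (offset F k.+1 <= offset F j)%N by apply: leq_offset2.
  rewrite offsetS in le_o.
  by rewrite oG ?(ltnW lt_kj) // ifT ?graft_cherry_out //; lia.
by rewrite leqNgt oG'.
Qed.

Lemma fpoly_no_fgen F i n :
  (exists G, F = fmul G (fgen i)) \/
  fpoly F (lower i.+1 \o succn) n = fpoly F (lower i \o succn) n.
Proof.
elim: n => [|n [|eqn]]; [by right; rewrite /fpoly !big_ord0 | by left |].
case: (leqP (offset F n) i) => [le_oi|lt_io]; last first.
  by right; rewrite !fpolyS eqn; congr (_ * _); apply: eq_in_tpoly => m _; rewrite /lower /=; lia.
case: (ltnP i (offset F n + nleaves (F n))) => [lt_i|le_i]; last first.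
  right; rewrite !fpolyS eqn; congr (_ * _); apply: eq_in_tpoly => m lt_m.
  by rewrite /lower /=; lia.
case: (tpoly_no_cherry (F n) (i - offset F n) i) => [[t lt_p Fn]|eqF].
  by left; apply: fmul_fgen_surj Fn.
right; rewrite !fpolyS eqn (eqF _ _ _ (split_hi_lo le_oi)) //; lia.
Qed.

End Split.

(** * Forest polynomials as products over trees *)

(** A coloring is encoded by the word of its colors, the nodes being listed as in
    [internals]. *)
Fixpoint words (t : btree) (b : nat -> nat) (a : nat) : seq (seq nat) :=
  if t is Node l r then
    [seq k :: w | k <- index_iota a (b 0%N),
       w <- [seq u ++ v | u <- words l b k,
                          v <- words r (fun m => b (nleaves l + m)%N) k.+1]]
  else [:: [::]].

(** The conditions of [tpoly] on a coloring given as a function on all paths.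
    Total functions spare the dependent types of [colorings]. *)
Fixpoint valid (t : btree) (b : nat -> nat) (a : nat) (kap : seq bool -> nat) : bool :=
  if t is Node l r then
    [&& (a <= kap [::] < b 0)%N,
        valid l b (kap [::]) (kap \o cons false)
      & valid r (fun m => b (nleaves l + m)%N) (kap [::]).+1 (kap \o cons true)]
  else true.

Lemma eq_valid t b a kap kap' : kap =1 kap' -> valid t b a kap = valid t b a kap'.
Proof.
elim: t b a kap kap' => //= l IHl r IHr b a kap kap' eqk; rewrite eqk.
by congr [&& _, _ & _]; [apply: IHl => p /= | apply: IHr => p /=]; rewrite eqk.
Qed.

Lemma wordsP t b a w :
  reflect (exists2 kap, valid t b a kap & w = map kap (internals t))
          (w \in words t b a).
Proof.
elim: t b a w => [|l IHl r IHr] b a w.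
  rewrite inE; apply: (iffP eqP) => [->|[]//].
  by exists (fun=> 0%N).
apply: (iffP allpairsPdep) => [[k [_ [kI /allpairsPdep[u [v [/IHl uI /IHr vI ->]]] ->]]]|].
  case: uI vI => [kl vl ->] [kr vr ->].
  exists (fun p => if p is c :: q then if c then kr q else kl q else k) => /=.
    by rewrite -mem_index_iota kI (eq_valid _ _ _ (kap' := kl)) // vl (eq_valid _ _ _ (kap' := kr)).
  by rewrite map_cat -!map_comp.
case=> kap /= /and3P[kI vl vr] ->; exists (kap [::]); eexists; split=> //.
  by rewrite mem_index_iota.
rewrite map_cat -!map_comp; apply: allpairs_f_dep.
  by apply/IHl; exists (kap \o cons false).
by apply/IHr; exists (kap \o cons true).
Qed.

Lemma uniq_words t b a : uniq (words t b a).
Proof.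
elim: t b a => [|l IHl r IHr] b a //=.
have size_words t0 b0 a0 w : w \in words t0 b0 a0 -> size w = size (internals t0).
  by case/wordsP => kap _ ->; rewrite size_map.
apply: allpairs_uniq_dep => [||[k w] [k' w'] _ _ /= [-> ->] //].
  exact: iota_uniq.
move=> k _; apply: allpairs_uniq => //.
move=> _ _ /allpairsPdep[u [v [uI vI ->]]] /allpairsPdep[u' [v' [u'I v'I ->]]] /= /eqP.
by rewrite eqseq_cat ?(size_words _ _ _ _ uI) ?(size_words _ _ _ _ u'I) // => /andP[/eqP-> /eqP->].
Qed.

Lemma tpoly_words (A : comNzRingType) (x : nat -> A) t b a :
  tpoly x t b a = \sum_(w <- words t b a) \prod_(k <- w) x k.
Proof.
elim: t b a => [|l IHl r IHr] b a.
  by rewrite tpoly_leaf big_seq1 big_nil.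
rewrite tpoly_node /= big_allpairs_dep; apply: eq_bigr => k _.
under [RHS]eq_bigr do rewrite big_cons.
rewrite -big_distrr /= big_allpairs_dep IHl IHr big_distrlr /=; congr (_ * _).
by apply: eq_bigr => u _; apply: eq_bigr => v _; rewrite big_cat.
Qed.

Definition nodes (F : forest) (n : nat) : seq (nat * seq bool) :=
  [seq (j, p) | j <- iota 0 n, p <- internals (F j)].

Definition fvalid (F : forest) (n : nat) (kap : nat * seq bool -> nat) : bool :=
  all (fun j => valid (F j) (fun m => (offset F j + m).+1) 0 (fun p => kap (j, p)))
      (iota 0 n).

Fixpoint fwords (F : forest) (n : nat) : seq (seq nat) :=
  if n is n'.+1 then
    [seq u ++ v | u <- fwords F n',
                  v <- words (F n') (fun m => (offset F n' + m).+1) 0]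
  else [:: [::]].

Lemma nodesS F n : nodes F n.+1 = nodes F n ++ [seq (n, p) | p <- internals (F n)].
Proof.
by rewrite /nodes -[n.+1]addn1 iotaD map_cat flatten_cat /= cats0.
Qed.

Lemma fvalidS F n kap : fvalid F n.+1 kap =
  fvalid F n kap && valid (F n) (fun m => (offset F n + m).+1) 0 (fun p => kap (n, p)).
Proof. by rewrite /fvalid -[n.+1]addn1 iotaD all_cat /= andbT. Qed.

Lemma mem_nodes F n v : (v \in nodes F n) = (v.1 < n)%N && (v.2 \in internals (F v.1)).
Proof.
case: v => j p; apply/allpairsPdep/andP => /= [[j' [p' [jI pI [-> ->]]]]|[lt_j pI]].
  by split=> //; rewrite mem_iota in jI.
by exists j, p; rewrite mem_iota.
Qed.

Lemma eq_in_fvalid F n kap kap' :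
  (forall j p, (j < n)%N -> kap (j, p) = kap' (j, p)) -> fvalid F n kap = fvalid F n kap'.
Proof.
move=> eqk; apply: eq_in_all => j; rewrite mem_iota => lt_j; apply: eq_valid => p.
exact: eqk.
Qed.

Lemma fwordsP F n w :
  reflect (exists2 kap, fvalid F n kap & w = map kap (nodes F n)) (w \in fwords F n).
Proof.
elim: n w => [|n IH] w.
  rewrite inE; apply: (iffP eqP) => [->|[]//].
  by exists (fun=> 0%N).
apply: (iffP allpairsPdep) => [[u [v [/IH[kap vkap ->] /wordsP[kn vn ->] ->]]]|].
  exists (fun v => if v.1 == n then kn v.2 else kap v).
    rewrite fvalidS; apply/andP; split; last by under eq_valid do rewrite /= eqxx.
    by rewrite -(@eq_in_fvalid _ _ kap) // => j p lt_j; rewrite /= ltn_eqF.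
  rewrite nodesS map_cat -map_comp; congr (_ ++ _); last by apply: eq_map => p /=; rewrite eqxx.
  apply/eq_in_map => -[j p]; rewrite mem_nodes => /andP[/= lt_j _].
  by rewrite ltn_eqF.
case=> kap; rewrite fvalidS nodesS map_cat -map_comp => /andP[vF vn] ->.
exists (map kap (nodes F n)); eexists; split=> //; first by apply/IH; exists kap.
by apply/wordsP; eexists; first exact: vn.
Qed.

Lemma uniq_internals t : uniq (internals t).
Proof.
have consI c : injective (cons c : seq bool -> seq bool) by move=> p q [].
elim: t => //= l IHl r IHr; apply/andP; split.
  by rewrite mem_cat; apply/norP; split; apply/mapP => -[].
rewrite cat_uniq !map_inj_uniq // IHl IHr andbT /=.
by apply/hasPn => _ /mapP[p _ ->]; apply/mapP => -[].
Qed.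

Lemma uniq_nodes F n : uniq (nodes F n).
Proof.
apply: allpairs_uniq_dep => [||[j p] [j' p'] _ _ /= [-> ->] //]; first exact: iota_uniq.
by move=> j _; exact: uniq_internals.
Qed.

Lemma uniq_fwords F n : uniq (fwords F n).
Proof.
elim: n => //= n IH; apply: allpairs_uniq => //; first exact: uniq_words.
have sz w : w \in fwords F n -> size w = size (nodes F n).
  by case/fwordsP => kap _ ->; rewrite size_map.
move=> _ _ /allpairsPdep[u [v [uI vI ->]]] /allpairsPdep[u' [v' [u'I v'I ->]]] /= /eqP.
by rewrite eqseq_cat ?(sz _ uI) ?(sz _ u'I) // => /andP[/eqP-> /eqP->].
Qed.

Lemma fpoly_fwords (A : comNzRingType) (x : nat -> A) F n :
  fpoly x F succn n = \sum_(w <- fwords F n) \prod_(k <- w) x k.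
Proof.
elim: n => [|n IH]; first by rewrite /fpoly big_ord0 big_seq1 big_nil.
rewrite fpolyS IH tpoly_words /= big_allpairs_dep big_distrlr /=.
by apply: eq_bigr => u _; apply: eq_bigr => v _; rewrite big_cat.
Qed.

Lemma index_leftmost t : index (leftmost t) (leaves t) = 0%N.
Proof.
have H : exists s, leaves t = leftmost t :: s.
  elim: t => [|l [s Es] r _] /=; first by exists [::].
  by rewrite Es /=; eexists.
by case: H => s ->; rewrite /= eqxx.
Qed.

Lemma mem_leaves_leftmost t p : p \in internals t ->
  p ++ leftmost (subtree t p) \in leaves t.
Proof.
have lm s : leftmost s \in leaves s.
  elim: s => //= l IHl r _; rewrite mem_cat map_f //.
elim: t p => //= l IHl r IHr p; rewrite inE => /predU1P[->|] /=.
  by rewrite mem_cat map_f ?lm.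
rewrite mem_cat => /orP[] /mapP[q qI ->] /=; rewrite mem_cat map_f ?orbT //.
  exact: IHl.
exact: IHr.
Qed.

Lemma index_leaves_l l r q : q \in leaves l ->
  index (false :: q) (leaves (Node l r)) = index q (leaves l).
Proof.
by move=> qI; rewrite /= index_cat map_f // index_map // => p p' [].
Qed.

Lemma index_leaves_r l r q :
  index (true :: q) (leaves (Node l r)) = (nleaves l + index q (leaves r))%N.
Proof.
rewrite /= index_cat ifN; last by apply/mapP => -[].
by rewrite size_map index_map // => p p' [].
Qed.

Lemma mem_internals_l l r q : (false :: q \in internals (Node l r)) = (q \in internals l).
Proof.
rewrite /= inE mem_cat /= mem_map; last by move=> p p' [].
by rewrite [X in _ || X](introF mapP) ?orbF // => -[].
Qed.

Lemma mem_internals_r l r q : (true :: q \in internals (Node l r)) = (q \in internals r).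
Proof.
rewrite /= inE mem_cat /= orbC mem_map; last by move=> p p' [].
by rewrite [X in _ || X](introF mapP) ?orbF // => -[].
Qed.


Definition node_ok (t : btree) (b : nat -> nat) (kap : seq bool -> nat) p : Prop :=
  [/\ (kap p < b (index (p ++ leftmost (subtree t p)) (leaves t)))%N,
      rcons p false \in internals t -> (kap p <= kap (rcons p false))%N &
      rcons p true \in internals t -> (kap p < kap (rcons p true))%N].

Lemma root_internals t : ([::] \in internals t) = (t != Leaf).
Proof. by case: t. Qed.

(** Prefixing paths by the step to a child matches the conditions inside a
    subtree with those of the whole tree; the lower bound [a] of a subtree
    carries the condition linking its root to the parent. *)
Lemma validP t b a kap :
  reflect ((t != Leaf -> (a <= kap [::])%N) /\
           forall p, p \in internals t -> node_ok t b kap p)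
          (valid t b a kap).
Proof.
elim: t b a kap => [|l IHl r IHr] b a kap; first by left.
have eql q : q \in internals l ->
    node_ok (Node l r) b kap (false :: q) <-> node_ok l b (kap \o cons false) q.
  move=> qI; rewrite /node_ok /= -/(leaves (Node l r)) -/(internals (Node l r)).
  by rewrite index_leaves_l ?mem_leaves_leftmost // !mem_internals_l.
have eqr q : q \in internals r -> node_ok (Node l r) b kap (true :: q) <->
    node_ok r (fun m => b (nleaves l + m)%N) (kap \o cons true) q.
  move=> qI; rewrite /node_ok /= -/(leaves (Node l r)) -/(internals (Node l r)).
  by rewrite index_leaves_r !mem_internals_r.
have eq0 : node_ok (Node l r) b kap [::] <->
    [/\ (kap [::] < b 0)%N, l != Leaf -> (kap [::] <= kap [:: false])%N
      & r != Leaf -> (kap [::] < kap [:: true])%N].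
  rewrite /node_ok [subtree _ _]/= cat0s index_leftmost /= -/(internals (Node l r)).
  by rewrite mem_internals_l mem_internals_r !root_internals.
apply: (iffP and3P) => [[/andP[le_a lt_b] /IHl[l0 lI] /IHr[r0 rI]]|[/(_ isT) le_a H]].
  split=> // p; case: p => [|[] q] pI; first exact/eq0.
    by rewrite mem_internals_r in pI; apply/eqr => //; apply: rI.
  by rewrite mem_internals_l in pI; apply/eql => //; apply: lI.
have /eq0[lt_b l0 r0] := H [::] isT.
split; first by rewrite le_a.
  apply/IHl; split=> // q qI; apply/eql => //; apply: H.
  by rewrite mem_internals_l.
apply/IHr; split=> // q qI; apply/eqr => //; apply: H.
by rewrite mem_internals_r.
Qed.

Lemma fvalidP F n kap :
  reflect (forall v, v \in nodes F n ->
     [/\ (kap v <= rho F v)%N,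
         lchild v \in nodes F n -> (kap v <= kap (lchild v))%N &
         rchild v \in nodes F n -> (kap v < kap (rchild v))%N])
   (fvalid F n kap).
Proof.
apply: (iffP allP) => [H [j p]|H j].
  rewrite !mem_nodes /= => /andP[lt_j pI].
  have /validP[_ /(_ p pI)] := H j ltac:(by rewrite mem_iota).
  by case=> h1 h2 h3; rewrite lt_j; split.
rewrite mem_iota add0n => /= lt_j; apply/validP; split=> // p pI.
have := H (j, p); rewrite !mem_nodes /= lt_j; case/(_ pI) => h1 h2 h3.
by split.
Qed.

Lemma mem_IN F n v : (fbound F <= n)%N -> (v \in IN F) = (v \in nodes F n).
Proof.
move=> le_n; rewrite seq_fsetE mem_nodes; case: v => j p.
apply/allpairsPdep/andP => /= [[j' [p' [jI pI [-> ->]]]]|[lt_j pI]].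
  split=> //; rewrite ltnNge; apply: contraL jI => le_j.
  by rewrite memNfinsupp fbound_leaf // (leq_trans le_n).
exists j, p; split=> //; rewrite mem_finsupp; apply: contraTneq pI => /= ->.
by [].
Qed.

(** Reading the colors along [nodes] is a bijection from the colorings of [F] to
    the words that the product over the trees enumerates. *)
Lemma forest_polyE F n : (fbound F <= n)%N -> forest_poly F = fpoly X F succn n.
Proof.
move=> le_n; rewrite fpoly_fwords.
pose coloring := {dffun forall v : IN F, 'I_(rho F (val v)).+1}.
pose ext (kap : coloring) v : nat :=
  if insub v is Some u then kap u else 0%N.
have extE (kap : coloring) (v : IN F) : ext kap (val v) = kap v by rewrite /ext valK.
pose word (kap : coloring) := map (ext kap) (nodes F n).
have wordE (kap : coloring) : \prod_(v : IN F) 'x_(kap v) = \prod_(k <- word kap) 'x_k.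
  rewrite /word big_map -[index_enum _]enumT.
  rewrite (eq_bigr (fun v : IN F => 'x_(ext kap (val v)))); last by move=> v _; rewrite extE.
  rewrite -(big_map val xpredT (fun v => 'x_(ext kap v))); apply: perm_big.
  apply: uniq_perm; [by rewrite map_inj_uniq ?enum_uniq //; exact: val_inj | exact: uniq_nodes |].
  move=> v; rewrite -(mem_IN _ le_n); apply/mapP/idP => [[u _ ->]|vI]; first exact: valP.
  by exists [` vI] => //; rewrite mem_enum.
have coloringE (kap : coloring) : (kap \in colorings F) = fvalid F n (ext kap).
  rewrite inE; apply/'forall_'forall_andP/fvalidP => [H v vI|H v w].
    have vF : v \in IN F by rewrite (mem_IN _ le_n).
    rewrite -[v]/(val [` vF]) extE; split; first by rewrite -ltnS.
      rewrite -(mem_IN _ le_n) => wI; rewrite -[lchild _]/(val [` wI]) extE.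
      by have [/implyP h _] := H [` vF] [` wI]; apply: h.
    rewrite -(mem_IN _ le_n) => wI; rewrite -[rchild _]/(val [` wI]) extE.
    by have [_ /implyP h] := H [` vF] [` wI]; apply: h.
  have vI := valP v; have wI := valP w; rewrite !(mem_IN _ le_n) in vI wI.
  have [_ hl hr] := H _ vI; rewrite -!extE.
  by split; apply/implyP => /eqP ew; rewrite ew in wI *; [apply: hl | apply: hr].
rewrite /forest_poly (eq_bigr (fun kap => \prod_(k <- word kap) 'x_k)); last by move=> kap _.
rewrite -big_enum -(big_map word xpredT (fun w => \prod_(k <- w) 'x_k)).
apply: perm_big; apply: uniq_perm; [|exact: uniq_fwords|].
  rewrite map_inj_uniq ?enum_uniq // => kap kap' /eq_in_map eqk.
  apply/ffunP => v; apply: ord_inj; rewrite -!extE; apply: eqk.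
  by rewrite -(mem_IN _ le_n); exact: valP.
move=> w; apply/mapP/fwordsP => [[kap]|[kap vkap ->]].
  by rewrite mem_enum coloringE => vk ->; exists (ext kap).
pose kap' : coloring :=
  [ffun v : IN F => inord (kap (val v)) : 'I_(rho F (val v)).+1].
have kapE : {in nodes F n, ext kap' =1 kap}.
  move=> v vI; have vF : v \in IN F by rewrite (mem_IN _ le_n).
  rewrite -[v]/(val [` vF]) extE ffunE inordK // ltnS.
  by have [] := elimT (fvalidP F n kap) vkap v vI.
exists kap'; last by apply/eq_in_map => v /kapE.
rewrite mem_enum coloringE; apply/fvalidP => v vI.
have [h1 h2 h3] := elimT (fvalidP F n kap) vkap v vI.
by split=> [|wI|wI]; rewrite !kapE //; [apply: h2 | apply: h3].
Qed.

(** * Trimming operators on forest polynomials *)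

Fact T_is_additive i : zmod_morphism (T i).
Proof.
move=> f g; rewrite /T -(raddfB (divX i)) !(rmorphB (R _)); congr (divX i _); ring.
Qed.

HB.instance Definition _ i :=
  GRing.isZmodMorphism.Build Pol Pol (T i) (T_is_additive i).

Fact ev0_is_additive : zmod_morphism ev0.
Proof. by move=> f g; rewrite /ev0 raddfB. Qed.

Fact ev0_is_multiplicative : monoid_morphism ev0.
Proof. by split=> [|f g]; rewrite /ev0 ?rmorph1 ?rmorphM. Qed.

HB.instance Definition _ := GRing.isZmodMorphism.Build Pol int ev0 ev0_is_additive.
HB.instance Definition _ :=
  GRing.isMonoidMorphism.Build Pol int ev0 ev0_is_multiplicative.

Lemma R_fpoly i F b n : R i (fpoly X F b n) = fpoly X F (lower i \o b) n.
Proof.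
by rewrite /fpoly rmorph_prod; apply: eq_bigr => j _; rewrite /= R_tpoly.
Qed.

Lemma T_forest_poly_fgen G i : T i (forest_poly (fmul G (fgen i))) = forest_poly G.
Proof.
pose n := maxn i.+1 (maxn (fbound G) (fbound (fmul G (fgen i)))).
rewrite !(@forest_polyE _ n) /n ?leq_max ?leqnn ?orbT //.
apply/esym/T_unique; rewrite !R_fpoly fpoly_fmul_fgen ifT; first by rewrite addrC addKr.
by apply: leq_trans (leq_offset _ _); rewrite leq_max leqnn.
Qed.

Lemma T_forest_poly_eq0 F i :
  (exists G, F = fmul G (fgen i)) \/ T i (forest_poly F) = 0.
Proof.
case: (fpoly_no_fgen X F i (fbound F)) => [|eqR]; [by left | right].
by apply/esym/T_unique; rewrite mulr0 (forest_polyE (leqnn _)) !R_fpoly eqR subrr.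
Qed.

Lemma ev0X i : ev0 'x_i = 0.
Proof.
rewrite -XE /ev0 mcoeffU1; case: eqP => // /(congr1 (fun m : {cmonom nat} => m i)).
by rewrite cmUU cm1.
Qed.

Lemma ev0_tpoly l r b a : ev0 (tpoly X (Node l r) b a) = 0.
Proof.
rewrite tpoly_node (rmorph_sum ev0) big1 // => k _.
by rewrite (rmorphM ev0) /= ev0X mul0r.
Qed.

Lemma ev0_forest_poly F : ev0 (forest_poly F) = (fempty == F)%:R.
Proof.
rewrite (forest_polyE (leqnn _)) rmorph_prod.
case: (boolP [forall j : 'I_(fbound F), F j == Leaf]) => [/forallP F0|].
  rewrite big1 => [|j _]; last by rewrite (eqP (F0 j)) rmorph1.
  suff -> : F = fempty by rewrite eqxx.
  apply/fsfunP => j; rewrite fsfunE; case: (ltnP j (fbound F)) => [lt_j|].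
    exact/eqP/(F0 (Ordinal lt_j)).
  exact: fbound_leaf.
rewrite negb_forall => /existsP[j Fj]; rewrite (bigD1 j) //=.
case Ej: (F j) Fj => [//|l r] _; rewrite ev0_tpoly mul0r.
by case: eqP => // /(congr1 (fun G : forest => G j)); rewrite fsfunE Ej.
Qed.

Lemma Tword_rcons w i f : Tword (rcons w i) f = Tword w (T i f).
Proof. by rewrite -cats1 Tword_cat. Qed.

Lemma Tword_is_additive w : zmod_morphism (Tword w).
Proof. by elim: w => //= i w IH f g; rewrite /= IH raddfB. Qed.

HB.instance Definition _ w :=
  GRing.isZmodMorphism.Build Pol Pol (Tword w) (Tword_is_additive w).

(** The last letter of [w] acts first, hence the induction from the right.  When
    [F = G . i], the needed cancellation [W . i = G . i -> W = G], for the forest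
    [W] spelled by [w], follows from the induction hypothesis: [T i] then gives
    [P_W = P_G], and the functional of [w] is 1 on the first. *)
Lemma ev0_Tword_forest_poly w F : ev0 (Tword w (forest_poly F)) = (fprod w == F)%:R.
Proof.
elim/last_ind: w F => [|w i IH] F; first exact: ev0_forest_poly.
rewrite Tword_rcons fprod_rcons; case: (T_forest_poly_eq0 F i) => [[G ->]|TF0].
  rewrite T_forest_poly_fgen IH; case: (fprod w =P G) => [->|neq]; first by rewrite eqxx.
  case: eqP => // eqG; case: neq; apply/eqP.
  (* Here [P_W = P_G], so the functional of [w] is 1 on [P_G] too. *)
  have := IH G; rewrite -(T_forest_poly_fgen G i) -eqG T_forest_poly_fgen IH eqxx.
  by case: eqP.
rewrite TF0 !raddf0; case: eqP => // eqF.
(* If [F = W . i] after all, then [P_W = T i P_F = 0], but it is sent to 1. *)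
have := IH (fprod w); rewrite -(T_forest_poly_fgen _ i) eqF TF0 !raddf0 eqxx.
by move/eqP.
Qed.

(** * Finiteness and spanning *)

(** Polynomials of degree less than [d] in the first [n] variables, generated so
    that the action of [R i] and [T i] is followed one variable at a time. *)
Inductive bounded (n : nat) : nat -> Pol -> Prop :=
| bounded0 d : bounded n d 0
| boundedC d c : bounded n d.+1 c%:~R
| boundedD d f g : bounded n d f -> bounded n d g -> bounded n d (f + g)
| boundedX d j f : (j < n)%N -> bounded n d f -> bounded n d.+1 ('x_j * f).

Lemma bounded_small n f : bounded n 0 f -> f = 0.
Proof.
move=> bf; have: 0%N = 0%N by []; move: bf.
move: {1 3}0%N => d; elim=> {d f} [//|//|d f g _ IHf _ IHg d0|//].
by rewrite IHf // IHg // addr0.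
Qed.

Lemma bounded_mono n n' d d' f : (n <= n')%N -> (d <= d')%N ->
  bounded n d f -> bounded n' d' f.
Proof.
move=> le_n le_d bf; elim: bf d' le_d => {d f}.
- by move=> d d' _; apply: bounded0.
- by move=> d c [//|d'] _; apply: boundedC.
- by move=> d f g _ IHf _ IHg d' le_d; apply: boundedD; [apply: IHf | apply: IHg].
- move=> d j f lt_j _ IH [//|d'] le_d; apply: boundedX; first exact: leq_trans le_n.
  exact: IH.
Qed.

Lemma boundedZ n d (c : int) f : bounded n d f -> bounded n d (c%:~R * f).
Proof.
elim=> {d f} [d|d c'|d f g _ IHf _ IHg|d j f lt_j _ IH].
- by rewrite mulr0; apply: bounded0.
- by rewrite -intrM; apply: boundedC.
- by rewrite mulrDr; apply: boundedD.
- by rewrite mulrCA; apply: boundedX.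
Qed.

Lemma bounded_exists f : exists n d, bounded n d f.
Proof.
elim/malg_ind: f => [|f g [n [d bf]] [n' [d' bg]]|c m].
- by exists 0%N, 0%N; apply: bounded0.
- exists (maxn n n'), (maxn d d'); apply: boundedD.
    by apply: bounded_mono bf; rewrite leq_maxl.
  by apply: bounded_mono bg; rewrite leq_maxr.
rewrite malgU_scale.
suff [n [d bm]] : exists n d, bounded n d << m >>.
  by exists n, d; apply: boundedZ.
elim/cmonom_ind: m => [|i m [n [d bm]]].
  by exists 0%N, 1%N; rewrite malg1E; apply: (boundedC _ _ 1).
exists (maxn i.+1 n), d.+1; rewrite -malgM_mono XE; apply: boundedX.
  by rewrite leq_maxl.
by apply: bounded_mono bm; rewrite ?leq_maxr.
Qed.

Lemma bounded_R n d i f : bounded n d f -> bounded n d (R i f).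
Proof.
elim=> {d f} [d|d c|d f g _ IHf _ IHg|d j f lt_j _ IH].
- by rewrite rmorph0; apply: bounded0.
- by rewrite rmorph_int; apply: boundedC.
- by rewrite rmorphD; apply: boundedD.
rewrite rmorphM /= RX_lower; case: eqP => [_|_]; first by rewrite mul0r; apply: bounded0.
by apply: boundedX => //; apply: leq_ltn_trans lt_j; exact: leq_subr.
Qed.

Lemma R_bounded_id n d i f : (n <= i)%N -> bounded n d f -> R i f = f.
Proof.
move=> le_ni; elim=> {d f} [d|d c|d f g _ IHf _ IHg|d j f lt_j _ IH].
- by rewrite rmorph0.
- by rewrite rmorph_int.
- by rewrite rmorphD /= IHf IHg.
by rewrite rmorphM /= IH RXlt // (leq_trans lt_j).
Qed.

Lemma T_bounded_eq0 n d i f : (n <= i)%N -> bounded n d f -> T i f = 0.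
Proof.
move=> le_ni bf; rewrite /T (R_bounded_id _ bf) 1?leqW // (R_bounded_id _ bf) //.
by rewrite subrr raddf0.
Qed.

(** A twisted Leibniz rule: with [R] and [R'] for [R i] and [R i.+1],
    [R' f R' g - R f R g = (R' f - R f) R' g + R f (R' g - R g)]. *)
Lemma T_mul i f g : T i (f * g) = T i f * R i.+1 g + R i f * T i g.
Proof.
have leibniz (A : comNzRingType) (x t s p q u v : A) : x * t = p - q -> x * s = u - v ->
    x * (t * u + q * s) = p * u - q * v.
  by move=> xt xs; rewrite mulrDr mulrA xt mulrCA xs; ring.
apply/esym/T_unique; rewrite (rmorphM (R i.+1)) (rmorphM (R i)).
exact: leibniz (mulX_T i f) (mulX_T i g).
Qed.

Lemma TX_const i j : exists c : int, T i 'x_j = c%:~R.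
Proof.
case: (ltngtP j i) => [lt_ji|lt_ij|->].
- by exists 0; apply/esym/T_unique; rewrite !RXlt ?subrr ?mulr0 // ltnW.
- case: j lt_ij => // j lt_ij.
  case: (eqVneq i j) => [->|neq_ij].
    exists (-1); apply/esym/T_unique.
    by rewrite RXeq RXgt // rmorphN rmorph1 mulrN mulr1 sub0r.
  exists 0; apply/esym/T_unique; rewrite !RXgt ?subrr ?mulr0 //.
  by rewrite ltn_neqAle neq_ij.
- by exists 1; apply/esym/T_unique; rewrite RXlt // RXeq mulr1 subr0.
Qed.

Lemma bounded_T n d i f : bounded n d f -> bounded n d.-1 (T i f).
Proof.
elim=> {d f} [d|d c|d f g _ IHf _ IHg|d j f lt_j bf IH].
- by rewrite raddf0; apply: bounded0.
- suff -> : T i c%:~R = 0 by apply: bounded0.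
  by apply/esym/T_unique; rewrite !rmorph_int subrr mulr0.
- by rewrite raddfD; apply: boundedD.
rewrite T_mul; have [c ->] := TX_const i j; apply: boundedD.
  by apply: boundedZ; apply: bounded_R.
case: d bf IH => [/bounded_small -> _|d bf IH] /=.
  by rewrite raddf0 mulr0; apply: bounded0.
rewrite RX_lower; case: eqP => [_|_]; first by rewrite mul0r; apply: bounded0.
by apply: boundedX => //; apply: leq_ltn_trans lt_j; exact: leq_subr.
Qed.

(** A superset of the words that act nontrivially on [bounded n d]. *)
Fixpoint short_words (n d : nat) : seq (seq nat) :=
  if d is d'.+1 then
    [::] :: [seq rcons w i | w <- short_words n d', i <- iota 0 n]
  else [::].

Lemma Tword_short n d f w : bounded n d f -> w \notin short_words n d -> Tword w f = 0.
Proof.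
elim: d f w => [|d IH] f w bf; first by move=> _; rewrite (bounded_small bf) raddf0.
case: (lastP w) => [//|w' i]; rewrite inE negb_or => /andP[_ wN].
rewrite Tword_rcons; case: (leqP n i) => [le_ni|lt_in].
  by rewrite (T_bounded_eq0 le_ni bf) raddf0.
apply: IH; first exact: bounded_T bf.
by apply: contra wN => w'I; apply: allpairs_f; rewrite ?mem_iota.
Qed.

Section IterMorphism.
Variables (A : nzRingType) (phi : {rmorphism A -> A}) (k : nat).

Lemma iter_rmorphM : {morph iter k phi : f g / f * g}.
Proof. by move=> f g; elim: k => //= m ->; rewrite rmorphM. Qed.

Lemma iter_rmorphD : {morph iter k phi : f g / f + g}.
Proof. by move=> f g; elim: k => //= m ->; rewrite rmorphD. Qed.

Lemma iter_rmorph_int (c : int) : iter k phi c%:~R = c%:~R.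
Proof. by elim: k => //= m ->; rewrite rmorph_int. Qed.

Lemma iter_rmorph0 : iter k phi 0 = 0.
Proof. exact: (iter_rmorph_int 0). Qed.

End IterMorphism.

(** If all [T i f] vanish then [R 0 f = R n f = f] for [n] large, so [f] equals its
    image under [n] iterations of [R 0], which kills the first [n] variables. *)
Lemma T_eq0_const f : (forall i, T i f = 0) -> f = (ev0 f)%:~R.
Proof.
move=> Tf; have [n [d bf]] := bounded_exists f.
have Rf i : R i f = R 0 f.
  elim: i => // i <-; apply/eqP; rewrite -subr_eq0 -mulX_T Tf mulr0 //.
have iterR k : iter k (R 0) f = f.
  by elim: k => //= k ->; rewrite -(Rf n) (R_bounded_id _ bf).
have [c fc] : exists c : int, f = c%:~R; last by rewrite fc rmorph_int intz.
rewrite -(iterR n); elim: bf => {d f Tf Rf iterR} [d|d c|d f g _ [c IHf] _ [c' IHg]|d j f lt_j _ _].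
- by exists 0; rewrite iter_rmorph0.
- by exists c; rewrite iter_rmorph_int.
- by exists (c + c'); rewrite iter_rmorphD IHf IHg rmorphD.
exists 0; rewrite iter_rmorphM; suff -> : iter n (R 0) 'x_j = 0 by rewrite mul0r.
elim: n j lt_j => // n IH [|j] lt_j; rewrite iterSr.
  by rewrite RXeq iter_rmorph0.
by rewrite RXgt // IH.
Qed.

(** The hypothesis passes from [f] to the [T i f], which have lower degree. *)
Lemma ev0_Tword_eq0 f : (forall w, ev0 (Tword w f) = 0) -> f = 0.
Proof.
have [n [d bf]] := bounded_exists f.
elim: d f bf => [|d IH] f bf Tf; first exact: bounded_small bf.
rewrite (T_eq0_const (f := f)); first by have /= -> := Tf [::].
move=> i; apply: IH; first exact: bounded_T bf.
by move=> w; rewrite -Tword_rcons.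
Qed.

Lemma ev0_Tword_lincomb w (c : {fsfun forest -> int with 0}) :
  ev0 (Tword w (lincomb forest_poly c)) = c (fprod w).
Proof.
have scaleE (a : int) (f : Pol) : a *: f = f *~ a by rewrite -[a in LHS]intz scaler_int.
rewrite /lincomb !raddf_sum /=.
under eq_bigr => F _ do rewrite scaleE !raddfMz /= ev0_Tword_forest_poly.
case: (boolP (fprod w \in finsupp c)) => [wI|wN].
  rewrite (big_fsetD1 _ wI) /= eqxx big1_fset ?addr0 => [|F]; first by rewrite intz.
  by rewrite !inE eq_sym => /andP[/negPf -> _] _; rewrite mul0rz.
rewrite fsfun_dflt // big1_fset // => F FI _.
by case: eqP FI wN => [->->|_ _ _] //; rewrite mul0rz.
Qed.

Lemma forest_expansion f : exists c : {fsfun forest -> int with 0},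
  (forall F, c F = ev0 (TFor F f)) /\ f = lincomb forest_poly c.
Proof.
have [n [d bf]] := bounded_exists f.
pose c : {fsfun forest -> int with 0} :=
  [fsfun F in seq_fset tt (map fprod (short_words n d)) => ev0 (TFor F f)].
have cE F : c F = ev0 (TFor F f).
  rewrite fsfun_fun seq_fsetE; case: ifPn => // FN.
  have [w /eqP Fw] := fprod_surj F; rewrite -Fw TForE (Tword_short bf) ?raddf0 //.
  by apply: contra FN => wI; rewrite -Fw map_f.
exists c; split=> //; apply/eqP; rewrite -subr_eq0; apply/eqP.
apply: ev0_Tword_eq0 => w; rewrite !raddfB /= ev0_Tword_lincomb cE TForE.
exact: subrr.
Qed.

(* [c] is the finitely supported family of coefficients of the expansion. *)
Theorem proposition6p7 :
  is_basis forest_poly /\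
  (forall f : Pol, exists c : {fsfun forest -> int with 0},
     (forall F : forest, c F = ev0 (TFor F f)) /\ f = lincomb forest_poly c).
Proof.
split; last exact: forest_expansion.
split=> [f|c c0 F]; first by have [c [_ ->]] := forest_expansion f; exists c.
have [w /eqP <-] := fprod_surj F.
by rewrite -ev0_Tword_lincomb c0 !raddf0.
Qed.
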